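(* Let $p$ be a prime and let $L$ be a finite-dimensional representation of $Y(\mathfrak{gl}_2)$ over $\overline{\mathbb{F}}_p$ which, as a $\mathfrak{gl}_2$-representation (via $E_{ij}\mapsto t_{ij}^{(1)}$), is isomorphic to $V(\mu^{(1)},p)\oplus\dots\oplus V(\mu^{(k)},p)$ with dominant integral weights $\mu^{(j)}=(\mu^{(j)}_1\ge\mu^{(j)}_2)$ and $p>\max_j(\mu^{(j)}_1-\mu^{(j)}_2)+1$. Suppose $L\cong L(\lambda(u),p)$ with $\lambda(u)=(\lambda_1(u),\lambda_2(u))$. Then there is a monic polynomial $P(u)\in\overline{\mathbb{F}}_p[u]$ such that $\frac{\lambda_1(u)}{\lambda_2(u)}=\frac{P(u+1)}{P(u)}$.
   Context: $Y(\mathfrak{gl}_2)$ over $\overline{\mathbb{F}}_p$ is generated by $t_{ij}^{(r)}$, $1\le i,j\le2$, $r\ge1$, with relations $[t_{ij}^{(r+1)},t_{kl}^{(s)}]-[t_{ij}^{(r)},t_{kl}^{(s+1)}]=t_{kj}^{(r)}t_{il}^{(s)}-t_{kj}^{(s)}t_{il}^{(r)}$, $t_{ij}^{(0)}=\delta_{ij}$; $t_{ij}(u)=\delta_{ij}+\sum_{r\ge1}t_{ij}^{(r)}u^{-r}$. For $\lambda_i(u)\in1+u^{-1}\overline{\mathbb{F}}_p[[u^{-1}]]$, $L(\lambda(u),p)$ is the irreducible quotient of the Verma module generated by $\xi$ with $t_{12}(u)\xi=0$, $t_{ii}(u)\xi=\lambda_i(u)\xi$. The Weyl module $V(\mu,p)$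 is the quotient of the $\mathfrak{gl}_2$-Verma module $M(\mu,p)$ with highest weight vector $v$ by the submodule generated by $f^{\mu_1-\mu_2+1}v$. *)

(* Defs.v *)
From HB Require Import structures.
From mathcomp Require Import all_boot all_order all_algebra.
Set Implicit Arguments. Unset Strict Implicit. Unset Printing Implicit Defensive.
Import GRing.Theory.
Local Open Scope ring_scope.

Definition i1 : 'I_2 := @ord0 1.
Definition i2 : 'I_2 := @ord_max 1.

(* A representation of Y(gl_2) on the column space F^n: T i j r is the action
   of t_{ij}^{(r)}; T i j 0 = delta_{ij} and the defining relations hold for
   all r, s >= 0. *)
Definition yangian_rep (F : fieldType) (n : nat)
    (T : 'I_2 -> 'I_2 -> nat -> 'M[F]_n) : Prop :=
  (forall i j, T i j 0%N = (i == j)%:R%:M) /\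
  (forall (i j k l : 'I_2) (r s : nat),
     (T i j r.+1 *m T k l s - T k l s *m T i j r.+1)
     - (T i j r *m T k l s.+1 - T k l s.+1 *m T i j r)
     = T k j r *m T i l s - T k j s *m T i l r).

(* Irreducibility: every invariant subspace is 0 or everything.  A subspace of
   column vectors is encoded by the row space of U (rows = transposed vectors). *)
Definition yirreducible (F : fieldType) (n : nat)
    (T : 'I_2 -> 'I_2 -> nat -> 'M[F]_n) : Prop :=
  (0 < n)%N /\
  forall U : 'M[F]_n,
    (forall i j r, (U *m (T i j r)^T <= U)%MS) -> U = 0 \/ row_full U.

(* L ~ L(lambda(u), p): L is irreducible and contains a nonzero vector xi with
   t_12(u) xi = 0 and t_ii(u) xi = lambda_i(u) xi; lam r is the coefficient of
   u^{-r}. *)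
Definition is_L_lambda (F : fieldType) (n : nat)
    (T : 'I_2 -> 'I_2 -> nat -> 'M[F]_n) (lam1 lam2 : nat -> F) : Prop :=
  yirreducible T /\
  exists xi : 'cV[F]_n, xi != 0 /\
    forall r : nat, (0 < r)%N ->
      [/\ T i1 i2 r *m xi = 0, T i1 i1 r *m xi = lam1 r *: xi
        & T i2 i2 r *m xi = lam2 r *: xi].

(* The Weyl module V(mu, p), mu = (a, b), a >= b, m = a - b: the quotient of the
   Verma module M(mu,p) by the submodule generated by f^{m+1} v, which has
   basis v_k = image of f^k v, 0 <= k <= m, with
     E11 v_k = (a - k) v_k, E22 v_k = (b + k) v_k,
     E21 v_k = v_{k+1} (v_{m+1} = 0), E12 v_k = k (m - k + 1) v_{k-1}.
   Matrix entry (r, c) is the coefficient of v_r in E_ij v_c. *)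
Definition weyl_dim (a b : int) : nat := (`|a - b|%N).+1.

Definition weyl_mx (F : fieldType) (a b : int) (i j : 'I_2) :
    'M[F]_(weyl_dim a b) :=
  let m := `|a - b|%N in
  \matrix_(r, c)
    (if i == i1 then
       (if j == i1 then (if r == c then (a - (c : nat)%:Z)%:~R else 0)
        else (if ((r : nat).+1 == c)%N then ((c : nat) * (m - c + 1))%:R else 0))
     else
       (if j == i1 then (if ((r : nat) == (c : nat).+1)%N then 1 else 0)
        else (if r == c then (b + (c : nat)%:Z)%:~R else 0))).

Definition gl2_iso_weyl_sum (F : fieldType) (n : nat)
    (T : 'I_2 -> 'I_2 -> nat -> 'M[F]_n) (K : nat) (mu1 mu2 : 'I_K -> int) : Prop :=
  exists S : 'M[F]_(n, \sum_(k < K) weyl_dim (mu1 k) (mu2 k)),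
    [/\ \rank S = n, \rank S = (\sum_(k < K) weyl_dim (mu1 k) (mu2 k))%N
      & forall i j : 'I_2,
          T i j 1%N *m S = S *m \mxdiag_(k < K) weyl_mx F (mu1 k) (mu2 k) i j].

(* Coefficient of u^e in the Laurent series P(u) * a(u), where
   a(u) = sum_{r >= 0} a r u^{-r}. *)
Definition mul_series_poly (F : fieldType) (a : nat -> F) (P : {poly F}) (e : int) : F :=
  \sum_(i < size P) P`_i * (if e <= (i : nat)%:Z then a `|(i : nat)%:Z - e|%N else 0).

(* Main.v *)
Require Import Defs.
From HB Require Import structures.
From mathcomp Require Import all_boot all_order all_algebra.
From mathcomp Require Import ring zify.
From Stdlib Require Import Classical.
Set Implicit Arguments.
Unset Strict Implicit.
Unset Printing Implicit Defensive.
Import GRing.Theory.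
Local Open Scope ring_scope.

(* Put f = t_21^(1). On every Weyl summand f^(p-1) = 0, so there is a least m
   with f^(m+1) xi = 0, and m + 1 < p. Commuting t_12(u) past f^(m+1) gives
   (m+1) (lambda_1(u) - t_22(u)) f^m xi = 0, so lambda_1(u) is an eigenvalue of
   t_22(u) on eta = f^m xi. Conversely let U be stable under t_22(u), and let U+
   be the span of all t_21^(s) U. Modulo lower terms of a flag of U on which
   t_22(u) acts by g(u), the operator t_22(u)/g(u) on U+ has the form
   1 + 1/(u - X), so each eigenvalue chi(u) of t_22(u) on a subquotient of U+
   satisfies (u - x) chi(u) = (u - x + 1) g(u) for some x. Going from the line of
   xi, where t_22(u) = lambda_2(u), up to eta in m steps expresses
   lambda_1(u)/lambda_2(u) as a product of factors (u - x_i + 1)/(u - x_i), and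
   P(u) is the product of the u - x_i. *)

(** * Extremal choices and eigenvectors modulo a subspace *)

Lemma ex_argmax (X : Type) (P : X -> Prop) (f : X -> nat) (b : nat) :
  (exists x, P x) -> (forall x, f x <= b)%N ->
  exists2 x, P x & forall y, P y -> (f y <= f x)%N.
Proof.
move=> [x0 Px0] fb.
suff H k : forall x, P x -> (b - f x <= k)%N ->
    exists2 x, P x & forall y, P y -> (f y <= f x)%N by exact: (H _ x0).
elim: k => [|k IHk] x Px.
  by rewrite leqn0 subn_eq0 => bfx; exists x => // y _; apply: leq_trans bfx.
move=> bfx; case: (classic (exists2 y, P y & (f x < f y)%N)) => [[y Py fxy]|max].
  apply: (IHk y Py); rewrite -ltnS; apply: leq_trans bfx.
  by have := fb y; lia.
by exists x => // y Py; rewrite leqNgt; apply/negP => fxy; apply: max; exists y.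
Qed.

(** By Cayley-Hamilton the product of the [M - c] over the roots [c] of the characteristic
    polynomial kills every row. Apply its factors one at a time to a row of [U] outside [V]: the
    last row before [V] is entered is the eigenvector. *)
Lemma eigenvector_modulo (F : closedFieldType) (n : nat) (M U V : 'M[F]_n) :
  (U *m M <= U)%MS -> ~~ (U <= V)%MS ->
  exists c (w : 'rV_n), [/\ (w <= U)%MS, ~~ (w <= V)%MS & (w *m M - c *: w <= V)%MS].
Proof.
case: n M U V => [|n] M U V; first by move=> _; rewrite (flatmx0 U) sub0mx.
move=> UM /row_subPn[i0 wV].
have wU : (row i0 U <= U)%MS by exact: row_sub.
move: (row i0 U) wU wV => w wU wV.
have [rs Ers] := closed_field_poly_normal (char_poly M).
have : (w *m horner_mx M (\prod_(z <- rs) ('X - z%:P)) <= V)%MS.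
  have /eqP := Cayley_Hamilton M; rewrite Ers (monicP (char_poly_monic M)) scale1r.
  by move=> /eqP->; rewrite mulmx0 sub0mx.
elim: rs {Ers} w wU wV => [|c rs IHrs] w wU wV.
  by rewrite big_nil rmorph1 mulmx1 (negbTE wV).
rewrite big_cons rmorphM rmorphB /= horner_mx_X horner_mx_C -mulmxE mulmxA mulmxBr mul_mx_scalar.
case: (boolP (w *m M - c *: w <= V)%MS) => [wMV _|]; first by exists c, w.
apply: IHrs; apply: addmx_sub; first exact: submx_trans (submxMr _ wU) UM.
by rewrite eqmx_opp scalemx_sub.
Qed.

(** * Products of a polynomial in u with a series in 1/u *)

Lemma mul_series_polyE (F : fieldType) (a : nat -> F) (P : {poly F}) (e : int) (N : nat) :
  (size P <= N)%N -> mul_series_poly a P e =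
    \sum_(i < N) P`_i * (if e <= (i : nat)%:Z then a `|(i : nat)%:Z - e|%N else 0).
Proof.
pose c i := P`_i * (if e <= i%:Z then a `|i%:Z - e|%N else 0).
move=> PN; rewrite /mul_series_poly (big_ord_widen N c PN).
rewrite big_mkcond /=; apply: eq_bigr => i _.
by case: ltnP => // Pi; rewrite nth_default ?mul0r.
Qed.

Lemma mul_series_poly_XsubC (F : fieldType) (a : nat -> F) (c : F) (P : {poly F}) (e : int) :
  mul_series_poly a (('X - c%:P) * P) e = mul_series_poly a P (e - 1) - c * mul_series_poly a P e.
Proof.
rewrite (@mul_series_polyE _ _ (_ * P) _ (size P).+1); last first.
  by apply: leq_trans (size_polyMleq _ _) _; rewrite size_XsubC.
rewrite [X in _ - _ * X](@mul_series_polyE _ _ P _ (size P).+1) // mulr_sumr.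
under eq_bigr => i _ do rewrite mulrBl coefB coefCM mulrBl -mulrA.
rewrite sumrB; congr (_ - _); rewrite big_ord_recl coefXM /= mul0r add0r.
apply: eq_bigr => i _; rewrite coefXM /=.
rewrite /bump /=; congr (_ * _).
have -> : (e <= (1 + i)%N%:Z) = ((e - 1)%R <= (i : nat)%:Z) by lia.
by case: ifP => // _; congr (a _); lia.
Qed.

(** The hypotheses are the coefficients of (u - x) chi(u) = (u - x + 1) g(u) at u and at each
    u^(-s). *)
Lemma mul_series_poly_shift (F : fieldType) (chi g : nat -> F) (x : F) (P : {poly F}) (e : int) :
  chi 0%N = g 0%N -> (forall s, chi s.+1 - x * chi s = g s.+1 - (x - 1) * g s) ->
  mul_series_poly chi (('X - x%:P) * P) e = mul_series_poly g (('X - (x - 1)%:P) * P) e.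
Proof.
move=> e0 es; rewrite !mul_series_poly_XsubC /mul_series_poly !mulr_sumr -!sumrB.
apply: eq_bigr => i _; rewrite !(mulrCA _ P`_i) -!mulrBr; congr (_ * _).
(* At [e = i + 1] only the constant terms of the two series contribute, which is where [e0]
   enters. *)
case: (Order.TotalTheory.ltgtP e ((i : nat)%:Z + 1)) => ei.
- have [-> ->] : ((e - 1)%R <= (i : nat)%:Z) /\ (e <= (i : nat)%:Z) by lia.
  by have -> : absz ((i : nat)%:Z - (e - 1))%R = (absz ((i : nat)%:Z - e)%R).+1 by lia.
- have [-> ->] : ((e - 1)%R <= (i : nat)%:Z) = false /\ (e <= (i : nat)%:Z) = false by lia.
  by rewrite !mulr0.
- have [-> ->] : ((e - 1)%R <= (i : nat)%:Z) /\ (e <= (i : nat)%:Z) = false by lia.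
  have -> : absz ((i : nat)%:Z - (e - 1))%R = 0%N by lia.
  by rewrite !mulr0 e0.
Qed.

(** This is chi(u)/lam(u) = P(u+1)/P(u) with denominators cleared. *)
Definition shift_ratio (F : fieldType) (chi lam : nat -> F) :=
  exists P : {poly F}, P \is monic /\
    forall e : int, mul_series_poly chi P e = mul_series_poly lam (P \Po ('X + 1)) e.

(** [P] gains the factor ['X - x%:P], which becomes ['X - (x - 1)%:P] under u -> u + 1. *)
Lemma shift_ratio_step (F : fieldType) (chi g lam : nat -> F) (x : F) :
  chi 0%N = g 0%N -> (forall s, chi s.+1 - x * chi s = g s.+1 - (x - 1) * g s) ->
  shift_ratio g lam -> shift_ratio chi lam.
Proof.
move=> e0 es [P [monP EP]]; exists (('X - x%:P) * P); split.
  by rewrite monicMr ?monicXsubC.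
move=> e; rewrite (mul_series_poly_shift P e e0 es) mul_series_poly_XsubC !EP.
rewrite -mul_series_poly_XsubC comp_polyM comp_polyB comp_polyX comp_polyC.
by rewrite polyCB opprB addrA.
Qed.

(** * Eigenvalues of t_22(u) after one application of the t_21^(s) *)

Section Lowering.

(* Transposition turns column vectors into rows acted on from the right:
   [A r] and [B r] stand for the transposes of [t_22^(r)] and [t_21^(r)]. *)
Variables (F : closedFieldType) (n : nat) (A B : nat -> 'M[F]_n).
Hypotheses (A0 : A 0%N = 1%:M) (B0 : B 0%N = 0).
Hypothesis AC : forall r s, A r *m A s = A s *m A r.
Hypothesis AB : forall r s,
  B r *m A s.+1 = A s.+1 *m B r + B r.+1 *m A s - A s *m B r.+1 + A s *m B r - A r *m B s.

Definition stable (U : 'M[F]_n) := forall r, (U *m A r <= U)%MS.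

(* [chi] is a joint eigenvalue of the [A r] on a subquotient of [U]. *)
Definition occurs (chi : nat -> F) (U : 'M[F]_n) :=
  exists (W : 'M_n) (w : 'rV_n), [/\ stable W, (w <= U)%MS, ~~ (w <= W)%MS
    & forall r, (w *m A r - chi r *: w <= W)%MS].

(* [V] is the sum of the [U *m B s]. *)
Definition lowering (U V : 'M[F]_n) :=
  (forall s, (U *m B s <= V)%MS) /\
  forall V' : 'M_n, (forall s, (U *m B s <= V')%MS) -> (V <= V')%MS.

(** The sum runs over infinitely many [s], so it is found as an upper bound of least rank:
    intersecting it with another upper bound cannot lower the rank. *)
Lemma lowering_exists (U : 'M[F]_n) : exists V, lowering U V.
Proof.
have [||V PV Vmin] := @ex_argmax 'M[F]_n (fun V => forall s, (U *m B s <= V)%MS)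
    (fun V => n - \rank V)%N n.
- by exists 1%:M => s; exact: submx1.
- by move=> V; apply: leq_subr.
exists V; split=> // V' PV'.
have /Vmin : forall s, (U *m B s <= V :&: V')%MS by move=> s; rewrite sub_capmx PV PV'.
rewrite leq_sub2lE ?rank_leq_row // => rkV.
have /leqifP := mxrank_leqif_sup (capmxSl V V').
case: ifP => [Vcap _|_]; first exact: submx_trans Vcap (capmxSr _ _).
by rewrite ltnNge rkV.
Qed.

(** The preimage of [Z] under [M] is the kernel of [M *m cokermx Z], a subspace containing every
    [U *m B s], hence [V]. *)
Lemma lowering_mulmx (U V M Z : 'M[F]_n) : lowering U V ->
  (forall s, (U *m B s *m M <= Z)%MS) -> (V *m M <= Z)%MS.
Proof.
case=> _ Vmin UZ; rewrite submxE -mulmxA -sub_kermx; apply: Vmin => s.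
by rewrite sub_kermx mulmxA -submxE.
Qed.

(** Induction on [r]: [AB] rewrites [B s *m A r.+1] into words that end in some [B] or in [A r]. *)
Lemma lowering_stable (U V : 'M[F]_n) : stable U -> lowering U V -> stable V.
Proof.
move=> stU UV r; apply: (lowering_mulmx UV).
have UAB s q : (U *m (A s *m B q) <= V)%MS.
  by rewrite mulmxA; apply: submx_trans (submxMr _ (stU s)) (UV.1 q).
elim: r => [|r IHr] s; first by rewrite A0 mulmx1 UV.1.
rewrite -mulmxA AB !(mulmxDr, mulmxBr, mulmxN) (mulmxA _ (B _)).
by rewrite !(addmx_sub, eqmx_opp).
Qed.

(** Take [U'] maximal among proper stable subspaces. An eigenspace of [A r] on [U] modulo [U'] is
    stable because the [A s] commute, and it is strictly larger than [U'], so it is all of [U]. *)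
Lemma scalar_quotient (U : 'M[F]_n) : stable U -> U != 0 ->
  exists (U' : 'M_n) (g : nat -> F),
    [/\ stable U', (U' <= U)%MS, ~~ (U <= U')%MS
      & forall r, (U *m A r - g r *: U <= U')%MS].
Proof.
move=> stU U0.
have [||U' [stU' sU'U nUU'] U'max] := @ex_argmax 'M[F]_n
    (fun V => [/\ stable V, (V <= U)%MS & ~~ (U <= V)%MS]) (fun V => \rank V) n.
- by exists 0; split=> [r||]; rewrite ?mul0mx ?sub0mx ?submx0.
- by move=> V; apply: rank_leq_row.
suff Hg r : exists c, (U *m A r - c *: U <= U')%MS.
  by exists U', (fun r => xchoose (Hg r)); split=> // r; exact: xchooseP (Hg r).
have [c [w [wU wU' wc]]] := eigenvector_modulo (stU r) nUU'.
exists c; pose V := (U :&: kermx ((A r - c%:M) *m cokermx U'))%MS.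
have inV m (Y : 'M_(m, n)) :
    (Y <= V)%MS = (Y <= U)%MS && (Y *m A r - c *: Y <= U')%MS.
  by rewrite sub_capmx sub_kermx mulmxA -submxE mulmxBr mul_mx_scalar.
have stV : stable V.
  move=> s; have := submx_refl V; rewrite inV => /andP[VU VU'].
  rewrite inV (submx_trans (submxMr _ VU) (stU s)) /=.
  rewrite -mulmxA -AC mulmxA scalemxAl -mulmxBl.
  exact: submx_trans (submxMr _ VU') (stU' s).
have U'V : (U' <= V)%MS.
  by rewrite inV sU'U addmx_sub // eqmx_opp scalemx_sub.
have wV : (w <= V)%MS by rewrite inV wU.
suff : (U <= V)%MS by rewrite inV => /andP[].
apply: contraT => nUV; have := U'max V (And3 stV (capmxSl _ _) nUV).
have /leqifP := mxrank_leqif_sup U'V.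
case: ifP => [VU'|_ ltU'V]; first by rewrite (submx_trans wV VU') in wU'.
by rewrite leqNgt ltU'V.
Qed.

(* If [A(u)] acts on [U/U'] as the scalar series [g(u)], then on [V/Z] the series
   [A(u)/g(u)] equals [1 + 1/(u - X)] with [X = A_2 - g_2 - g_1]. *)
Lemma lowering_recurrence (U U' V Z : 'M[F]_n) (g : nat -> F) :
  lowering U V -> stable Z -> g 0%N = 1 ->
  (forall s, (U' *m B s <= Z)%MS) ->
  (forall r, (U *m A r - g r *: U <= U')%MS) ->
  forall s, (V *m (A s.+1 - (g s.+1)%:M
    - (A 2 - (g 2%N + g 1%N)%:M) *m (A s - (g s)%:M) - (g s)%:M) <= Z)%MS.
Proof.
move=> UV stZ g0 U'B Ug s; apply: (lowering_mulmx UV) => r; rewrite submxE.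
pose b r := U *m B r; pose q := cokermx Z.
have UAB k l : U *m (A k *m B l) *m q = g k *: (b l *m q).
  apply/eqP; rewrite -subr_eq0 scalemxAl -mulmxBl -submxE mulmxA scalemxAl -mulmxBl.
  exact: submx_trans (submxMr _ (Ug k)) (U'B l).
have rel k l : b k *m A l.+1 *m q = g l.+1 *: (b k *m q) + b k.+1 *m A l *m q
    - g l *: (b k.+1 *m q) + g l *: (b k *m q) - g k *: (b l *m q).
  rewrite -!UAB /b -!mulmxA (mulmxA (B k)) AB !(mulmxDl, mulmxBl, mulmxDr, mulmxBr, mulNmx, mulmxN).
  by rewrite -!mulmxA.
have b0 : b 0%N = 0 by rewrite /b B0 mulmx0.
have rel1 k : b k *m A 1 *m q = (g 1%N + 1) *: (b k *m q).
  by rewrite rel g0 A0 b0 mul0mx scaler0 subr0 mulmx1 !scale1r addrK scalerDl scale1r.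
(* Modulo [Z], b_(k+1) = b_k X + g_k b_1. *)
have relb k : (b k.+1 - b k *m A 2 + (g 2%N + g 1%N) *: b k - g k *: b 1%N <= Z)%MS.
  rewrite submxE !(mulmxDl, mulNmx) -!scalemxAl rel rel1.
  apply/eqP; move: (b k.+1 *m q) (b k *m q) (b 1%N *m q) => x y z.
  by apply/matrixP => i j; rewrite !mxE; ring.
(* Since [b 0 = 0], the relation at index 0 reads b_1 (A_s - g_s) = b_s modulo [Z]. *)
have bA : b 1%N *m A s *m q = g s *: (b 1%N *m q) + b s *m q.
  have := rel 0%N s; rewrite b0 !mul0mx !scaler0 g0 scale1r !addr0 add0r.
  move/eqP; rewrite eq_sym subr_eq0 subr_eq addrC => /eqP ->; by rewrite addrC.
(* [e2 - g s *: e1] is [relb r] times A_s - g_s. It eliminates b_(r+1) from [rel r s], and by [bA]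
   the two terms g_r b_s cancel. *)
have e1 := relb r; have e2 := submx_trans (submxMr (A s) e1) (stZ s).
rewrite !submxE -/q !(mulmxDl, mulNmx) -!scalemxAl in e1 e2.
move/eqP: e1 => e1; move/eqP: e2 => e2.
rewrite -/(b r) -/q.
have -> : b r *m (A s.+1 - (g s.+1)%:M - (A 2 - (g 2%N + g 1%N)%:M) *m (A s - (g s)%:M) -
    (g s)%:M) *m q = b r *m A s.+1 *m q - g s.+1 *: (b r *m q) - b r *m A 2 *m A s *m q
    + g s *: (b r *m A 2 *m q) + (g 2%N + g 1%N) *: (b r *m A s *m q)
    - ((g 2%N + g 1%N) * g s) *: (b r *m q) - g s *: (b r *m q).
  rewrite !(mulmxBr, mulmxBl) !mul_mx_scalar !mul_scalar_mx.
  rewrite -!scalemxAr !mul_mx_scalar -!scalemxAl !mulmxA !scalemxAl.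
  rewrite -!scalemxAl scalerA.
  move: (b r *m A s.+1 *m q) (b r *m q) (b r *m A 2 *m A s *m q) (b r *m A 2 *m q) (b r *m A s *m q).
  by move=> *; apply/matrixP => i j; rewrite !mxE; ring.
rewrite rel; rewrite bA in e2; apply/eqP; move: e1 e2.
move: (b r.+1 *m A s *m q) (b r *m A s *m q) (b r *m A 2 *m A s *m q) (b r *m A 2 *m q).
move: (b r.+1 *m q) (b r *m q) (b s *m q) (b 1%N *m q) => x1 x2 x3 x4 x5 x6 x7 x8 e1 e2.
apply/matrixP => i j; move/matrixP/(_ i j): e1; move/matrixP/(_ i j): e2; rewrite !mxE.
move=> e2 e1.
transitivity (0 - g s * 0 : F); last by rewrite mulr0 subr0.
by rewrite -{1}e2 -e1; ring.
Qed.

(** Induction on the rank of [U], peeling off one scalar quotient [U/U'] at a time. *)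
Lemma occurs_lowering (U V : 'M[F]_n) (chi : nat -> F) :
  stable U -> lowering U V -> occurs chi V ->
  exists g x, [/\ occurs g U, chi 0%N = g 0%N
    & forall s, chi s.+1 - x * chi s = g s.+1 - (x - 1) * g s].
Proof.
move=> stU UV [W [w [stW wV wW wchi]]].
have [d] := ubnP (\rank U); elim: d => // d IHd in U V w stU UV wV wW wchi *.
rewrite ltnS => rkU.
have [U0|U0] := eqVneq U 0.
  have /(submx_trans wV) : (V <= (0 : 'M_n))%MS by apply: UV.2 => s; rewrite U0 mul0mx.
  by move=> /submx_trans/(_ (sub0mx _ W)); rewrite (negbTE wW).
have [U' [g [stU' U'U nUU' Ug]]] := scalar_quotient stU U0.
have [V' UV'] := lowering_exists U'.
have stV' := lowering_stable stU' UV'.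
(* If [w] comes from [V'] modulo [W], the induction hypothesis for [U'] applies. Otherwise [w]
   survives modulo [V' + W], where [lowering_recurrence] holds. *)
have [wV'W|wV'W] := boolP (w <= V' + W)%MS.
  have /sub_addsmxP[[a1 a2] /= Ew] := wV'W.
  have w2W : (a2 *m W <= W)%MS by exact: submxMl.
  have Ew1 : a1 *m V' = w - a2 *m W by rewrite Ew addrK.
  have [||||g' [x [occ e0 es]]] := IHd _ _ (a1 *m V') stU' UV'.
  - exact: submxMl.
  - by apply: contraNN wW => w1W; rewrite Ew addmx_sub.
  - move=> r; rewrite Ew1 mulmxBl scalerBr opprB [_ - chi r *: w]addrC addrACA.
    apply: addmx_sub (wchi r) (addmx_sub _ (scalemx_sub _ w2W)).
    by rewrite eqmx_opp (submx_trans (submxMr _ w2W)).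
  - by apply: leq_trans rkU; apply: rank_ltmx; rewrite ltmxE U'U.
  exists g', x; split=> //; case: occ => W' [w' [? w'U' ? ?]].
  by exists W', w'; split=> //; apply: submx_trans U'U.
pose Z := (V' + W)%MS.
have stZ : stable Z by move=> r; rewrite addsmxMr; apply: addsmxS.
have /row_subPn[i0 zU'] := nUU'.
have zU : (row i0 U <= U)%MS by exact: row_sub.
move: (row i0 U) zU zU' => z zU zU'.
have g0 : g 0%N = 1.
  apply/eqP; rewrite eq_sym -subr_eq0; apply: contraNT nUU' => c0.
  have := Ug 0%N; rewrite A0 mulmx1 -[X in X - _]scale1r -scalerBl.
  by rewrite (eqmx_scale U c0).
have V'Z s : (U' *m B s <= Z)%MS by exact: submx_trans (UV'.1 s) (addsmxSl _ _).
pose q := cokermx Z; have wq : w *m q != 0 by rewrite -submxE.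
have wA r : w *m A r *m q = chi r *: (w *m q).
  apply/eqP; rewrite -subr_eq0 scalemxAl -mulmxBl -submxE.
  exact: submx_trans (wchi r) (addsmxSr _ _).
have wA2 r : w *m A 2 *m A r *m q = (chi 2%N * chi r) *: (w *m q).
  rewrite -scalerA -wA; apply/eqP; rewrite -subr_eq0 !scalemxAl -!mulmxBl -submxE.
  exact: submx_trans (submxMr _ (submx_trans (wchi 2%N) (addsmxSr _ _))) (stZ r).
have scal a : a *: (w *m q) = 0 -> a = 0.
  by move/eqP; rewrite scaler_eq0 (negbTE wq) orbF => /eqP.
(* [x] is the eigenvalue of X = A_2 - g_2 - g_1 on [w] modulo [Z]. *)
exists g, (chi 2%N - (g 2%N + g 1%N)); split.
- exists U', z; split=> // r; rewrite -mul_mx_scalar -mulmxBr.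
  apply: submx_trans (submxMr _ zU) _; by rewrite mulmxBr mul_mx_scalar.
- apply/eqP; rewrite g0 eq_sym -subr_eq0; apply/eqP/scal.
  by rewrite scalerBl -wA A0 mulmx1 scale1r subrr.
move=> s; have := lowering_recurrence UV stZ g0 V'Z Ug s.
move/(submx_trans (submxMr _ wV)); rewrite submxE -/q => /eqP E; clearbody q.
apply/eqP; rewrite -subr_eq0; apply/eqP/scal; rewrite -[RHS]E.
rewrite !(mulmxBr, mulmxBl) !mul_mx_scalar !mul_scalar_mx -!scalemxAr.
rewrite !mul_mx_scalar !mulmxA -!scalemxAl wA2 !wA.
by apply/matrixP => i j; rewrite !mxE; ring.
Qed.

(** Start from the line of [xi], where only [lam] occurs and [P = 1]; each lowering contributes one
    linear factor. *)
Lemma shift_ratio_iter (xi : 'rV[F]_n) (lam : nat -> F) (k : nat) :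
  (forall r, xi *m A r = lam r *: xi) ->
  exists U, [/\ stable U, (iter k (mulmxr (B 1)) xi <= U)%MS
    & forall chi, occurs chi U -> shift_ratio chi lam].
Proof.
move=> xiA; elim: k => [|k [U [stU xiU occU]]].
  exists <<xi>>%MS; split=> [r||chi]; rewrite ?genmxE //.
    by rewrite (eqmxMr _ (genmxE xi)) xiA scalemx_sub.
  case=> W [w [_ /[!genmxE]/sub_rVP[a ->] wW wchi]].
  exists 1; split=> [|e]; first exact: monic1.
  have lamchi r : chi r = lam r.
    apply/esym/eqP; rewrite -subr_eq0; apply: contraNT wW => c0.
    by have := wchi r; rewrite -scalemxAl xiA scalerA mulrC -scalerA -scalerBl (eqmx_scale _ c0).
  rewrite rmorph1; apply: eq_bigr => i _; by rewrite lamchi.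
have [V UV] := lowering_exists U.
exists V; split; first exact: lowering_stable stU UV.
  exact: submx_trans (submxMr _ xiU) (UV.1 1%N).
move=> chi /(occurs_lowering stU UV)[g [x [occ e0 es]]].
exact: shift_ratio_step e0 es (occU g occ).
Qed.

End Lowering.

(** * Strings under f = t_21^(1) *)

Section ExtremalVector.

Variables (F : fieldType) (n : nat) (T : 'I_2 -> 'I_2 -> nat -> 'M[F]_n).
Hypothesis hT : yangian_rep T.

(** The defining relation at [r = 0], where t_ij^(0) is scalar and its commutator vanishes. *)
Lemma yangian_comm1 (i j k l : 'I_2) (s : nat) :
  T i j 1%N *m T k l s = T k l s *m T i j 1%N
    + (k == j)%:R *: T i l s - (i == l)%:R *: T k j s.
Proof.
have [T0 /(_ i j k l 0%N s)] := hT; rewrite !T0 !mul_scalar_mx !mul_mx_scalar subrr subr0.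
by move/eqP; rewrite subr_eq => /eqP->; rewrite addrC addrA.
Qed.

Variables (xi : 'cV[F]_n) (lam1 : nat -> F) (r : nat).
Hypotheses (xi12 : T i1 i2 r *m xi = 0) (xi11 : T i1 i1 r *m xi = lam1 r *: xi).

Let f := T i2 i1 1%N.
Let v k := iter k (mulmx f) xi.

Let f_t11 : f *m T i1 i1 r = T i1 i1 r *m f + T i2 i1 r.
Proof. by rewrite yangian_comm1 /= scale1r scale0r subr0. Qed.

Let f_t12 : f *m T i1 i2 r = T i1 i2 r *m f + T i2 i2 r - T i1 i1 r.
Proof. by rewrite yangian_comm1 /= !scale1r. Qed.

Let f_t21 : f *m T i2 i1 r = T i2 i1 r *m f.
Proof. by rewrite yangian_comm1 /= !scale0r addr0 subr0. Qed.

Let f_t22 : f *m T i2 i2 r = T i2 i2 r *m f - T i2 i1 r.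
Proof. by rewrite yangian_comm1 /= scale0r scale1r addr0. Qed.

(** Each passage past [f] drops one t_21^(r); these commute with [f], so equal terms collect. *)
Lemma t11_string k :
  T i1 i1 r *m v k.+1 = lam1 r *: v k.+1 - k.+1%:R *: (T i2 i1 r *m v k).
Proof.
have t11f w : T i1 i1 r *m (f *m w) = f *m (T i1 i1 r *m w) - T i2 i1 r *m w.
  by rewrite !mulmxA f_t11 mulmxDl addrK.
elim: k => [|k IHk]; first by rewrite t11f xi11 -scalemxAr scale1r.
have ft21 : f *m (T i2 i1 r *m v k) = T i2 i1 r *m v k.+1.
  by rewrite mulmxA f_t21 -mulmxA.
rewrite [LHS](t11f _ (v k.+1)) IHk mulmxBr -!scalemxAr ft21.
by rewrite -addrA -opprD -[k.+2%:R]natr1 scalerDl scale1r.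
Qed.

(** The analogue for all [r] of the sl_2 formula for e f^(k+1) on a highest weight vector. The
    t_21^(r) terms from moving t_11^(r) and t_22^(r) combine. *)
Lemma t12_string k :
  T i1 i2 r *m v k.+1 = k.+1%:R *: (lam1 r *: v k - T i2 i2 r *m v k).
Proof.
have t12f w : T i1 i2 r *m (f *m w) =
    f *m (T i1 i2 r *m w) - T i2 i2 r *m w + T i1 i1 r *m w.
  by rewrite !mulmxA f_t12 mulmxBl mulmxDl addrAC subrK addrK.
elim: k => [|k IHk]; first by rewrite t12f xi12 xi11 mulmx0 add0r scale1r addrC.
have ft22 : f *m (T i2 i2 r *m v k) = T i2 i2 r *m v k.+1 - T i2 i1 r *m v k.
  by rewrite mulmxA f_t22 mulmxBl -mulmxA.
rewrite [LHS](t12f _ (v k.+1)) IHk t11_string -scalemxAr mulmxBr -scalemxAr ft22 -[f *m v k]/(v k.+1).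
move: (v k.+1) (T i2 i2 r *m _) (T i2 i1 r *m _) => x y z.
by apply/matrixP => a b; rewrite !mxE -!natr1; ring.
Qed.

End ExtremalVector.

(** * Nilpotency of f on sums of Weyl modules *)

Lemma mxdiag_nilpotent (F : fieldType) (K : nat) (d : 'I_K -> nat) (D : forall k, 'M[F]_(d k))
    (N m : nat) (X : 'M[F]_(\sum_k d k, m)) :
  (forall k (Y : 'M[F]_(d k, m)), iter N (mulmx (D k)) Y = 0) ->
  iter N (mulmx (\mxdiag_k D k)) X = 0.
Proof.
move=> D0; have -> : iter N (mulmx (\mxdiag_k D k)) X =
    \mxcol_k iter N (mulmx (D k)) (submxcol X k).
  elim: N {D0} => [|N IHN]; first by rewrite submxcolK.
  by rewrite iterS IHN mul_mxdiag_mxcol.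
by apply/mxcolP => k; rewrite mxcolK D0 submxcol0.
Qed.

Lemma weyl_f_nilpotent (F : fieldType) (a b : int) (N m : nat)
    (Y : 'M[F]_(weyl_dim a b, m)) :
  (weyl_dim a b <= N)%N -> iter N (mulmx (weyl_mx F a b i2 i1)) Y = 0.
Proof.
(* [f] sends v_c to v_(c+1), so k applications clear the first k coordinates. *)
move=> dN; suff H k : forall (r : 'I_(weyl_dim a b)) c, (r < k)%N ->
    iter k (mulmx (weyl_mx F a b i2 i1)) Y r c = 0.
  by apply/matrixP => r c; rewrite H ?mxE // (leq_trans (ltn_ord r)).
elim: k => // k IHk r c rk; rewrite iterS mxE big1 // => j _; rewrite mxE /=.
by case: eqP => [rj|_]; rewrite ?mul0r // IHk ?mulr0 // -ltnS -rj.
Qed.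

Lemma weyl_sum_f_nilpotent (F : fieldType) (n : nat) (T : 'I_2 -> 'I_2 -> nat -> 'M[F]_n)
    (K : nat) (mu1 mu2 : 'I_K -> int) (N : nat) (x : 'cV[F]_n) :
  gl2_iso_weyl_sum T mu1 mu2 -> (forall k, weyl_dim (mu1 k) (mu2 k) <= N)%N ->
  iter N (mulmx (T i2 i1 1%N)) x = 0.
Proof.
move=> [S [rkS _ TS]] dN.
have freeS : row_free S by rewrite /row_free rkS.
(* The two dimensions of [S] are not convertible, so [pinvmx S] serves as its right inverse. *)
have -> : x = S *m (pinvmx S *m x) by rewrite mulmxA mulmxVp ?mul1mx.
have -> y : iter N (mulmx (T i2 i1 1%N)) (S *m y) =
    S *m iter N (mulmx (\mxdiag_k weyl_mx F (mu1 k) (mu2 k) i2 i1)) y.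
  by elim: N {dN} => // N IHN; rewrite !iterS IHN mulmxA TS mulmxA.
by rewrite mxdiag_nilpotent ?mulmx0 // => k Y; apply: weyl_f_nilpotent.
Qed.

(** * The end of the string and the conclusion *)

Lemma pcharf_natr_neq0 (F : fieldType) (p k : nat) :
  p \in [pchar F] -> (0 < k < p)%N -> k%:R != 0 :> F.
Proof. by move=> pF /andP[k0 kp]; rewrite -(dvdn_pcharf pF) gtnNdvd. Qed.

Lemma extremal_vector (p : nat) (F : fieldType) (n : nat)
    (T : 'I_2 -> 'I_2 -> nat -> 'M[F]_n) (xi : 'cV[F]_n) (lam1 : nat -> F) :
  p \in [pchar F] -> yangian_rep T -> lam1 0%N = 1 -> xi != 0 ->
  iter p.-1 (mulmx (T i2 i1 1%N)) xi = 0 ->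
  (forall r, (0 < r)%N -> T i1 i2 r *m xi = 0 /\ T i1 i1 r *m xi = lam1 r *: xi) ->
  exists m, let v := iter m (mulmx (T i2 i1 1%N)) xi in
    v != 0 /\ forall r, T i2 i2 r *m v = lam1 r *: v.
Proof.
move=> pF hT lam10 xi0 fp hxi; pose v k := iter k (mulmx (T i2 i1 1%N)) xi.
have exv : exists k, v k == 0 by exists p.-1; apply/eqP.
case: (ex_minnP exv) => [[|m] /eqP vm vmin]; first by rewrite -vm eqxx in xi0.
exists m; split; first by apply/negP => /vmin; rewrite ltnn.
case=> [|r]; first by rewrite hT.1 mul1mx lam10 scale1r.
have [x12 x11] := hxi r.+1 isT.
have := t12_string hT x12 x11 m; rewrite -/(v m.+1) vm mulmx0 => /esym/eqP.
(* Minimality gives m + 1 <= p - 1, so m + 1 is nonzero in [F] and can be cancelled. *)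
rewrite scaler_eq0 subr_eq0 (negbTE (pcharf_natr_neq0 pF _)) => [/eqP//|].
have := vmin p.-1; rewrite /v fp eqxx => /(_ isT).
by have := prime_gt0 (pcharf_prime pF); lia.
Qed.

Unset Implicit Arguments.

Theorem theorem3p2p4 (p : nat) (F : closedFieldType)
  (hp : prime p) (hchar : p \in [pchar F])
  (hFp : forall x : F, exists k : nat, (0 < k)%N /\ x ^+ (p ^ k) = x)
  (n : nat) (T : 'I_2 -> 'I_2 -> nat -> 'M[F]_n) (hT : yangian_rep T)
  (K : nat) (mu1 mu2 : 'I_K -> int)
  (hdom : forall k, mu2 k <= mu1 k)
  (hbound : forall k, (`|mu1 k - mu2 k|%N + 1 < p)%N)
  (hiso : gl2_iso_weyl_sum T mu1 mu2)
  (lam1 lam2 : nat -> F) (hl1 : lam1 0%N = 1) (hl2 : lam2 0%N = 1)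
  (hL : is_L_lambda T lam1 lam2) :
  exists P : {poly F}, P \is monic /\
    forall e : int, mul_series_poly lam1 P e = mul_series_poly lam2 (P \Po ('X + 1)) e.
Proof.
have [_ [xi [xi0 hxi]]] := hL; have [T0 Trel] := hT.
(* By [hbound] every Weyl summand has dimension at most p - 1. *)
have fp : iter p.-1 (mulmx (T i2 i1 1%N)) xi = 0.
  apply: weyl_sum_f_nilpotent hiso _ => k; have := hbound k; rewrite /weyl_dim; lia.
have [|m [v0 vA]] := extremal_vector hchar hT hl1 xi0 fp.
  by move=> r /hxi[].
pose A r := (T i2 i2 r)^T; pose B r := (T i2 i1 r)^T.
have A0 : A 0%N = 1%:M by rewrite /A T0 trmx1.
have B0 : B 0%N = 0 by rewrite /B T0 /= raddf0 trmx0.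
(* With all indices 2 the relation trades [t^(r+1), t^(s)] for [t^(r), t^(s+1)], so induction on [r]
   descends to t^(0) = 1. *)
have AC r s : A r *m A s = A s *m A r.
  rewrite /A -!trmx_mul; congr trmx; elim: r s => [|r IHr] s.
    by rewrite T0 mul1mx mulmx1.
  apply/eqP; have /eqP := Trel i2 i2 i2 i2 r s.
  by rewrite (IHr s.+1) (IHr s) !subrr subr0 subr_eq0 eq_sym.
have AB r s : B r *m A s.+1 =
    A s.+1 *m B r + B r.+1 *m A s - A s *m B r.+1 + A s *m B r - A r *m B s.
  apply: trmx_inj; rewrite !(raddfD, raddfN) /= !trmx_mul !trmxK.
  apply/eqP; rewrite -subr_eq0; have /eqP := Trel i2 i1 i2 i2 r s.
  rewrite -subr_eq0 => /eqP <-; apply/eqP.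
  by apply/matrixP => a b; rewrite !mxE; ring.
have xiA r : xi^T *m A r = lam2 r *: xi^T.
  rewrite /A -trmx_mul -linearZ /=; congr trmx.
  by case: r => [|r]; [rewrite T0 mul1mx hl2 scale1r | have [] := hxi r.+1 isT].
have [U [stU vU occU]] := shift_ratio_iter A0 B0 AC AB m xiA.
(* f^m xi is a true eigenvector of t_22(u), so the subquotient is taken modulo 0. *)
apply: occU; exists 0, (iter m (mulmx (T i2 i1 1%N)) xi)^T; split.
- by move=> r; rewrite mul0mx sub0mx.
- apply: submx_trans vU; rewrite (_ : _^T = iter m (mulmxr (B 1%N)) xi^T) //.
  by elim: m {v0 vA} => //= m IHm; rewrite trmx_mul IHm.
- by rewrite submx0 trmx_eq0.
- by move=> r; rewrite /A -trmx_mul vA linearZ subrr sub0mx.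
Qed.
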